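(* Let $H$ and $K$ be separable Hilbert spaces and let $I,J$ be countable index sets. Let $\{W_i\}_{i\in I}$ be a frame of subspaces with respect to $\{u_i\}_{i\in I}$ for $H$, with frame bounds $A,B$, and let $\{Z_j\}_{j\in J}$ be a frame of subspaces with respect to $\{v_j\}_{j\in J}$ for $K$, with frame bounds $A',B'$. Then $\{W_i\otimes Z_j\}_{i\in I,\,j\in J}$ is a frame of subspaces with respect to $\{u_iv_j\}_{i\in I,\,j\in J}$ for $H\otimes K$, with frame bounds $AA'$ and $BB'$. It is tight (respectively Parseval) if $\{W_i\}_{i\in I}$ and $\{Z_j\}_{j\in J}$ are tight (respectively Parseval).
   Context: Let $H$ be a separable Hilbert space and $\{v_i\}_{i\in I}$ a family of weights, i.e. $v_i>0$ for all $i$. A family $\{W_i\}_{i\in I}$ of closed subspaces of $H$ is a frame of subspaces with respect to $\{v_i\}_{i\in I}$, with frame bounds $A,B$, if $A,B>0$ are real numbers such that for every $x\in H$ $$A\|x\|^2\le\sum_{i\in I}v_i^2\|\pi_{W_i}(x)\|^2\le B\|x\|^2,$$ where $\pi_{W_i}$ is the orthogonal projection of $H$ onto $W_i$. It is tight if $A=B$, and Parseval if $A=B=1$. $H\otimes K$ is the Hilbert space tensor product, and $W_i\otimes Z_j$ is regarded as the closed subspace of $H\otimes K$ that is the closed span of $\{x\otimes y: x\in W_i, y\in Z_j\}$. *)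

(* Defs.v *)
From HB Require Import structures.
From mathcomp Require Import all_boot all_order all_algebra.
From mathcomp Require Import complex.
From mathcomp Require Import all_classical all_reals.
From mathcomp Require Import ereal topology normedtype esum.

Set Implicit Arguments.
Unset Strict Implicit.
Unset Printing Implicit Defensive.

Import Order.TTheory GRing.Theory Num.Theory.
Import numFieldNormedType.Exports.

Local Open Scope classical_set_scope.
Local Open Scope ring_scope.

(* Hilbert spaces are over the real or the complex numbers; both cases are
   treated uniformly. *)
Variant scalar_kind := RealScalars | ComplexScalars.

Definition scalar_field (R : realType) (k : scalar_kind) : numFieldType :=
  match k with RealScalars => R | ComplexScalars => R[i] end.

Definition conj_scalar (R : realType) (k : scalar_kind) :
    scalar_field R k -> scalar_field R k :=
  match k with
  | RealScalars => fun x : R => x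
  | ComplexScalars => fun z : R[i] => conjc z
  end.
Arguments conj_scalar {R k} _.

Lemma conj_scalar_is_zmod_morphism (R : realType) (k : scalar_kind) :
  zmod_morphism (@conj_scalar R k).
Proof. by case: k => // x y; exact: (rmorphB (@conjc R)). Qed.

Lemma conj_scalar_is_monoid_morphism (R : realType) (k : scalar_kind) :
  monoid_morphism (@conj_scalar R k).
Proof.
case: k => //; split; first exact: (rmorph1 (@conjc R)).
by move=> x y; exact: (rmorphM (@conjc R)).
Qed.

HB.instance Definition _ (R : realType) (k : scalar_kind) :=
  GRing.isZmodMorphism.Build (scalar_field R k) (scalar_field R k)
    (@conj_scalar R k)
    (@conj_scalar_is_zmod_morphism R k).

HB.instance Definition _ (R : realType) (k : scalar_kind) :=
  GRing.isMonoidMorphism.Build (scalar_field R k) (scalar_field R k)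
    (@conj_scalar R k)
    (@conj_scalar_is_monoid_morphism R k).

Definition re_scalar (R : realType) (k : scalar_kind) : scalar_field R k -> R :=
  match k with
  | RealScalars => fun x : R => x
  | ComplexScalars => fun z : R[i] => complex.Re z
  end.
Arguments re_scalar {R k} _.

HB.mixin Record isHilbert (R : realType) (k : scalar_kind) (H : Type)
    of CompleteNormedModule (scalar_field R k) H := {
  inner : {dot H for @conj_scalar R k};
  norm_inner : forall x : H, `|x| ^+ 2 = inner x x
}.

#[short(type="hilbertType")]
HB.structure Definition Hilbert (R : realType) (k : scalar_kind) :=
  { H of CompleteNormedModule (scalar_field R k) H & isHilbert R k H }.

(* MathComp-Analysis norms take their values in the scalar field, even when it
   is complex; this is the same (nonnegative) number in [R]. *)
Definition hnorm (R : realType) (k : scalar_kind) (H : hilbertType R k)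
  (x : H) : R := re_scalar `|x|.

Definition separable_space (T : topologicalType) : Prop :=
  exists D : set T, countable D /\ dense D.

Section Subspaces.
Context {R : realType} {k : scalar_kind} {H : hilbertType R k}.

Definition closed_subspace (W : set H) : Prop :=
  [/\ W 0,
      forall (a : scalar_field R k) (x y : H), W x -> W y -> W (a *: x + y)
    & closed W].

Definition linear_span (S : set H) : set H :=
  [set x | exists (n : nat) (a : 'I_n -> scalar_field R k) (s : 'I_n -> H),
     (forall i, S (s i)) /\ x = \sum_(i < n) a i *: s i].

Definition closed_span (S : set H) : set H := closure (linear_span S).

(* The point [y] of [W] with [x - y] orthogonal to [W]; it exists and is unique
   when [W] is a closed subspace (junk value [0] otherwise). *)
Definition orth_proj (W : set H) (x : H) : H :=
  xget 0 [set y | W y /\ forall z, W z -> inner (x - y) z = 0].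

Definition frame_of_subspaces (I : countType) (W : I -> set H) (v : I -> R)
    (A B : R) : Prop :=
  [/\ forall i, closed_subspace (W i),
      forall i, 0 < v i,
      0 < A,
      0 < B
    & forall x : H,
        ((A * hnorm x ^+ 2)%:E
           <= \esum_(i in [set: I])
                (v i ^+ 2 * hnorm (orth_proj (W i) x) ^+ 2)%:E)%E /\
        (\esum_(i in [set: I])
            (v i ^+ 2 * hnorm (orth_proj (W i) x) ^+ 2)%:E
           <= (B * hnorm x ^+ 2)%:E)%E].

Definition tight_frame_of_subspaces (I : countType) (W : I -> set H)
    (v : I -> R) : Prop :=
  exists A : R, frame_of_subspaces W v A A.

Definition parseval_frame_of_subspaces (I : countType) (W : I -> set H)
    (v : I -> R) : Prop :=
  frame_of_subspaces W v 1 1.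

End Subspaces.

Section TensorProduct.
Context {R : realType} {k : scalar_kind} {H K T : hilbertType R k}.

Definition simple_tensors (t : H -> K -> T) (W : set H) (Z : set K) : set T :=
  [set z | exists x y, [/\ W x, Z y & z = t x y]].

(* [T], with [t x y] in the role of [x (x) y], is the completion of the
   algebraic tensor product of [H] and [K] for the inner product determined by
   <x (x) y, x' (x) y'> = <x, x'> <y, y'>. The product formula makes the linear
   span of the simple tensors a copy of the algebraic tensor product, and [T],
   being complete, is its completion as soon as this span is dense. These
   conditions determine [(T, t)] up to a unique unitary isomorphism. *)
Definition is_hilbert_tensor_product (t : {bilinear H -> K -> T}) : Prop :=
  (forall (x x' : H) (y y' : K),
     inner (t x y) (t x' y') = inner x x' * inner y y') /\
  dense (linear_span (simple_tensors t setT setT)).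

Definition tensor_subspace (t : H -> K -> T) (W : set H) (Z : set K) : set T :=
  closed_span (simple_tensors t W Z).

End TensorProduct.

(* Main.v *)
Require Import Defs.
From HB Require Import structures.
From mathcomp Require Import all_boot all_order all_algebra.
From mathcomp Require Import complex.
From mathcomp Require Import all_classical all_reals.
From mathcomp Require Import ereal topology normedtype esum.
From mathcomp Require Import ring lra.

Set Implicit Arguments.
Unset Strict Implicit.
Unset Printing Implicit Defensive.

Import Order.TTheory GRing.Theory Num.Theory.
Import numFieldNormedType.Exports.

Local Open Scope classical_set_scope.
Local Open Scope ring_scope.

(** The projection onto [W_i (x) Z_j] is [P_i (x) Q_j], the product of
    [P_i (x) 1] and [1 (x) Q_j], which are the projections onto [W_i (x) K] and
    [H (x) Z_j] ([orth_proj_tensor_subspace]). The double sum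
    [sum_ij u_i^2 v_j^2 |(P_i (x) Q_j) z|^2] is therefore an iterated one, and
    it is enough to know that tensoring a frame with a whole space keeps its
    bounds: the bounds [A'], [B'] of [(H (x) Z_j)_j] apply to each
    [(P_i (x) 1) z], and then the bounds [A], [B] of [(W_i (x) K)_i] apply
    to [z] ([frame_tensor]).

    That [(W_i (x) K)_i] has the bounds [A], [B] is [frame_tensor_l]; the other
    factor follows by exchanging the roles of [H] and [K]. On the span of the
    simple tensors, Gram-Schmidt in [K] gives [z = sum_k x_k (x) e_k] with
    orthogonal [e_k]. Then [|z|^2 = sum_k |x_k|^2 |e_k|^2] and
    [|(P_i (x) 1) z|^2 = sum_k |P_i x_k|^2 |e_k|^2], so that the frame
    inequalities for [z] are the combinations with weights [|e_k|^2] of those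
    for the [x_k]. The span is dense, and the inequalities pass to its
    closure because both sides are bounded by a multiple of [|z|^2] and are
    squares of seminorms, a property used only through the Young type
    inequality [f (x + y) <= (1 + c) f x + (1 + 1/c) f y]
    ([le_young_bound_dense]).

    The existence of orthogonal projections is the classical theorem on nearest
    points ([exists_nearest]). Real and complex scalars are treated together:
    norms are compared as elements of [R], and [real_scalar], the embedding of
    [R] into the scalars, relates them to inner products. *)

(** * Real numbers as scalars *)

Section Scalars.
Context {R : realType} {k : scalar_kind}.
Local Notation S := (scalar_field R k).

Definition real_scalar : R -> S :=
  match k with
  | RealScalars => fun x : R => x
  | ComplexScalars => fun x : R => Complex x 0
  end.

Lemma re_real_scalar x : re_scalar (real_scalar x) = x.
Proof. by rewrite /real_scalar; case: k. Qed.

Lemma ge0_real_scalar (a : S) : 0 <= a -> real_scalar (re_scalar a) = a.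
Proof.
rewrite /real_scalar; case: k a => //= a a0; exact/RRe_real/ger0_real.
Qed.

Lemma real_scalarD x y : real_scalar (x + y) = real_scalar x + real_scalar y.
Proof. by rewrite /real_scalar; case: k => //; exact: (rmorphD (real_complex R)). Qed.

Lemma real_scalarM x y : real_scalar (x * y) = real_scalar x * real_scalar y.
Proof. by rewrite /real_scalar; case: k => //; exact: (rmorphM (real_complex R)). Qed.

Lemma ler_real_scalar x y : (real_scalar x <= real_scalar y) = (x <= y).
Proof. by rewrite /real_scalar; case: k => //; exact: lecR. Qed.

Lemma ltr_real_scalar x y : (real_scalar x < real_scalar y) = (x < y).
Proof. by rewrite /real_scalar; case: k => //; exact: ltcR. Qed.

Lemma real_scalar0 : real_scalar 0 = 0.
Proof. by rewrite /real_scalar; case: k. Qed.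

Lemma real_scalar_inj : injective real_scalar.
Proof. by move=> x y /(congr1 re_scalar); rewrite !re_real_scalar. Qed.

End Scalars.

(** * Norm and inner product *)

Section HilbertNorm.
Context {R : realType} {k : scalar_kind} {H : hilbertType R k}.
Implicit Types (x y z w : H) (a : scalar_field R k).

Lemma real_hnorm x : real_scalar (hnorm x) = `|x|.
Proof. exact: ge0_real_scalar. Qed.

Lemma hnorm_ge0 x : 0 <= hnorm x.
Proof. by rewrite -(@ler_real_scalar R k) real_scalar0 real_hnorm. Qed.

Lemma hnorm0 : hnorm (0 : H) = 0.
Proof. by apply: (@real_scalar_inj R k); rewrite real_hnorm normr0 real_scalar0. Qed.

Lemma hnorm_eq0 x : hnorm x = 0 -> x = 0.
Proof. by move=> x0; apply/normr0_eq0; rewrite -real_hnorm x0 real_scalar0. Qed.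

Lemma hnorm_oppr x : hnorm (- x) = hnorm x.
Proof. by rewrite /hnorm normrN. Qed.

Lemma ler_hnormD x y : hnorm (x + y) <= hnorm x + hnorm y.
Proof. by rewrite -(@ler_real_scalar R k) real_scalarD !real_hnorm ler_normD. Qed.

Lemma hnormZ a x : hnorm (a *: x) = re_scalar `|a| * hnorm x.
Proof.
apply: (@real_scalar_inj R k).
by rewrite real_scalarM !real_hnorm ge0_real_scalar// normrZ.
Qed.

Lemma inner_hnorm x : inner x x = real_scalar (hnorm x ^+ 2).
Proof. by rewrite -norm_inner !expr2 real_scalarM real_hnorm. Qed.

Lemma inner_sym x y : inner x y = conj_scalar (inner y x).
Proof. by rewrite (hermC (@inner R k H)) expr0 mul1r. Qed.

Lemma inner_sym0 x y : inner x y = 0 -> inner y x = 0.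
Proof. by rewrite (inner_sym y x) => ->; rewrite rmorph0. Qed.

Lemma innerDl z : {morph inner^~ z : x y / x + y}.
Proof. exact: (linearDl (@inner R k H)). Qed.

Lemma innerBl z : {morph inner^~ z : x y / x - y}.
Proof. exact: (linearBl (@inner R k H)). Qed.

Lemma innerZl a x y : inner (a *: x) y = a * inner x y.
Proof. exact: (linearZl_LR (@inner R k H)). Qed.

Lemma innerDr x : {morph inner x : y z / y + z}.
Proof. exact: (linearDr (@inner R k H)). Qed.

Lemma innerBr x : {morph inner x : y z / y - z}.
Proof. exact: (linearBr (@inner R k H)). Qed.

Lemma innerZr a x y : inner x (a *: y) = conj_scalar a * inner x y.
Proof. exact: (linearZr_LR (@inner R k H)). Qed.

Lemma inner0r x : inner x 0 = 0.
Proof. exact: (linear0r (@inner R k H)). Qed.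

Lemma inner_suml (I : Type) (r : seq I) (f : I -> H) y :
  inner (\sum_(i <- r) f i) y = \sum_(i <- r) inner (f i) y.
Proof. exact: (linear_sumlz (@inner R k H)). Qed.

Lemma hnorm_pythagoras x y :
  inner x y = 0 -> hnorm (x + y) ^+ 2 = hnorm x ^+ 2 + hnorm y ^+ 2.
Proof.
move=> xy; apply: (@real_scalar_inj R k); rewrite real_scalarD -!inner_hnorm.
exact: (hnormDd (form := @inner R k H)).
Qed.

Lemma hnorm_parallelogram x y :
  hnorm (x + y) ^+ 2 + hnorm (x - y) ^+ 2 = 2 * (hnorm x ^+ 2 + hnorm y ^+ 2).
Proof.
apply: (@real_scalar_inj R k).
rewrite mulr_natl mulr2n !real_scalarD -!inner_hnorm.
by rewrite innerDr innerBr !innerBl !innerDl; ring.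
Qed.

(** If no multiple of [z] brings [w] closer to the origin, then [w] is
    orthogonal to [z]: subtracting from [w] its component along [z] would
    shorten it by exactly the length of this component. *)
Lemma orthogonal_of_shortest w z :
  (forall a, hnorm w <= hnorm (w - a *: z)) -> inner w z = 0.
Proof.
move=> wmin; have [->|z0] := eqVneq z 0; first exact: inner0r.
have zz0 : inner z z != 0.
  by rewrite lt0r_neq0 ?neq0_dnorm_gt0.
set a := inner w z / inner z z.
have orth : inner (w - a *: z) (a *: z) = 0.
  by rewrite innerZr innerBl innerZl divfK// subrr mulr0.
have := hnorm_pythagoras orth; rewrite subrK => wE.
have : hnorm (a *: z) ^+ 2 <= 0.
  have : hnorm w ^+ 2 <= hnorm (w - a *: z) ^+ 2 by rewrite lerXn2r ?nnegrE ?hnorm_ge0.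
  by rewrite wE; lra.
rewrite real_exprn_even_le0//= => /eqP/hnorm_eq0/eqP.
rewrite scaler_eq0 (negbTE z0) orbF /a mulf_eq0 invr_eq0 (negbTE zz0) orbF.
by move/eqP.
Qed.

(** Balls have their radii in the scalar field; only positive ones matter, and
    these come from [R]. *)
Lemma closure_hnormP (D : set H) x :
  closure D x <-> forall e : R, 0 < e -> exists2 y, D y & hnorm (x - y) < e.
Proof.
split=> [Dx e e0|Dx B /nbhs_ballP[e /= e0 eB]].
  have e0' : 0 < real_scalar e :> scalar_field R k.
    by rewrite -real_scalar0 ltr_real_scalar.
  have [y [Dy]] := Dx _ (nbhsx_ballx x (real_scalar e) e0').
  rewrite -ball_normE /= -real_hnorm ltr_real_scalar => xy.
  by exists y.
have re0 : 0 < re_scalar e.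
  by rewrite -(@ltr_real_scalar R k) ge0_real_scalar ?ltW// real_scalar0.
have [y Dy xy] := Dx _ re0; exists y; split=> //; apply: eB.
by rewrite -ball_normE /= -real_hnorm -(ge0_real_scalar (ltW e0)) ltr_real_scalar.
Qed.

End HilbertNorm.

(** * Orthogonal projections *)

Section Projection.
Context {R : realType} {k : scalar_kind} {H : hilbertType R k}.
Implicit Types (x y z w : H) (a : scalar_field R k) (W S : set H).

Section ClosedSubspace.
Variables (W : set H) (W_closed : closed_subspace W).

Lemma closed_subspaceZ a x : W x -> W (a *: x).
Proof.
by case: W_closed => W0 Wlin _ Wx; rewrite -[a *: x]addr0; exact: Wlin.
Qed.

Lemma closed_subspaceD x y : W x -> W y -> W (x + y).
Proof.
by case: W_closed => _ Wlin _ Wx Wy; rewrite -[x]scale1r; exact: Wlin.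
Qed.

Lemma closed_subspaceB x y : W x -> W y -> W (x - y).
Proof.
by move=> Wx Wy; rewrite -scaleN1r; apply/closed_subspaceD/closed_subspaceZ.
Qed.

(** By the parallelogram identity, two points of [W] that are almost nearest to
    [x] are close to each other, since their midpoint is in [W] and cannot be
    much nearer. The sets of almost nearest points thus generate a Cauchy
    filter, whose limit is the nearest point. *)
Lemma exists_nearest x :
  exists2 y, W y & forall z, W z -> hnorm (x - y) <= hnorm (x - z).
Proof.
have [W0 _ W_cl] := W_closed.
pose dists := [set hnorm (x - y) | y in W].
have infP : has_inf dists.
  split; first by exists (hnorm (x - 0)), 0.
  by exists 0 => _ [y _ <-]; exact: hnorm_ge0.
pose d := inf dists.
have d_le y : W y -> d <= hnorm (x - y).
  by move=> Wy; apply: inf_lbound; [exact: infP.2|exists y].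
have d0 : 0 <= d.
  by apply: lb_le_inf; [exact: infP.1|move=> _ [y _ <-]; exact: hnorm_ge0].
pose near e := [set y | W y /\ hnorm (x - y) < d + e].
have near_ex e : 0 < e -> exists y, near e y.
  move=> e0; have [_ [y Wy <-] ylt] := inf_adherent e0 infP.
  by exists y; split.
(* the midpoint of two points of [W] is in [W], hence at distance at least [d] *)
have near_diam e y y' : near e y -> near e y' ->
    hnorm (y - y') ^+ 2 <= 4 * ((d + e) ^+ 2 - d ^+ 2).
  move=> [Wy yd] [Wy' yd'].
  have := hnorm_parallelogram (x - y) (x - y').
  have -> : x - y - (x - y') = - (y - y').
    by rewrite !opprB addrC addrA subrK.
  rewrite hnorm_oppr.
  have two0 : (2 : scalar_field R k) != 0 by rewrite pnatr_eq0.
  have -> : x - y + (x - y') = 2 *: (x - 2^-1 *: (y + y')).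
    rewrite scalerBr scalerA divff// scale1r scaler_nat mulr2n.
    by rewrite addrACA -opprD.
  have mid_le : d <= hnorm (x - 2^-1 *: (y + y')).
    by apply: d_le; apply: closed_subspaceZ; exact: closed_subspaceD.
  rewrite hnormZ.
  have -> : re_scalar `|2 : scalar_field R k| = 2 :> R.
    apply: (@real_scalar_inj R k); rewrite ge0_real_scalar// normr_nat.
    rewrite -[2 : R]/(1 + 1) real_scalarD.
    by rewrite /real_scalar; case: (k).
  have sq_le s : W s -> hnorm (x - s) < d + e -> hnorm (x - s) ^+ 2 <= (d + e) ^+ 2.
    move=> Ws sd; rewrite lerXn2r ?nnegrE ?hnorm_ge0 ?ltW//.
    exact: le_lt_trans (hnorm_ge0 _) sd.
  have := sq_le _ Wy yd; have := sq_le _ Wy' yd'.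
  have : d ^+ 2 <= hnorm (x - 2^-1 *: (y + y')) ^+ 2.
    by rewrite lerXn2r ?nnegrE ?hnorm_ge0.
  rewrite exprMn; lra.
pose F := filter_from [set e : R | 0 < e] near.
have F_filter : Filter F.
  apply: filter_from_filter; first by exists 1; rewrite /= ltr01.
  move=> e e' e0 e'0; exists (Num.min e e'); first by rewrite /= lt_min e0.
  move=> y [Wy yd]; split; split=> //; apply: lt_le_trans yd _.
    by rewrite lerD2l ge_min lexx.
  by rewrite lerD2l ge_min lexx orbT.
have F_proper : ProperFilter F.
  by apply: filter_from_proper => e; exact: near_ex.
(* [e2 <= 1] makes the bound [4 * ((d + e2) ^+ 2 - d ^+ 2)] of [near_diam]
   linear in [e2] *)
have F_cauchy : cauchy F.
  apply: cauchy_exP => e e0.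
  have re0 : 0 < re_scalar e.
    by rewrite -(@ltr_real_scalar R k) ge0_real_scalar ?ltW// real_scalar0.
  set e1 := re_scalar e in re0.
  pose e2 := Num.min 1 (e1 ^+ 2 / (8 * d + 5)).
  have den0 : 0 < 8 * d + 5 by lra.
  have e20 : 0 < e2 by rewrite lt_min ltr01 divr_gt0// exprn_gt0.
  have e21 : e2 <= 1 by rewrite ge_min lexx.
  have e2_le : e2 * (8 * d + 5) <= e1 ^+ 2.
    by rewrite -ler_pdivlMr// ge_min lexx orbT.
  have [y ny] := near_ex _ e20; exists y; exists e2 => // y' ny'.
  rewrite -ball_normE /= -real_hnorm -(ge0_real_scalar (ltW e0)) ltr_real_scalar.
  rewrite -(@ltr_pXn2r _ 2) ?nnegrE ?hnorm_ge0 ?(ltW re0)//.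
  apply: le_lt_trans (near_diam _ _ _ ny ny') _.
  rewrite -/e1; nra.
have F_cvg : F --> lim F by apply: cauchy_cvg.
set y := lim F in F_cvg.
have approx e : 0 < e -> exists2 s, near e s & hnorm (y - s) < e.
  move=> e0.
  have e0' : 0 < real_scalar e :> scalar_field R k.
    by rewrite -real_scalar0 ltr_real_scalar.
  have [e' e'0 sub] := F_cvg _ (nbhsx_ballx y (real_scalar e) e0').
  have [s [Ws sd]] := near_ex (Num.min e e') (ltac:(by rewrite lt_min e0)).
  exists s.
    by split=> //; apply: lt_le_trans sd _; rewrite lerD2l ge_min lexx.
  have : near e' s.
    by split=> //; apply: lt_le_trans sd _; rewrite lerD2l ge_min lexx orbT.
  by move=> /sub; rewrite -ball_normE /= -real_hnorm ltr_real_scalar.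
exists y.
  rewrite (iffLR (closure_id _) W_cl); apply/closure_hnormP => e /approx[s [Ws _]].
  by exists s.
move=> z Wz; apply: le_trans (d_le _ Wz); apply/ler_addgt0Pr => e e0.
have [|s [_ sd] ys] := approx (e / 2); first by rewrite divr_gt0.
have -> : x - y = (x - s) + (s - y) by rewrite addrA subrK.
apply: le_trans (ler_hnormD _ _) _.
rewrite -(opprB y s) hnorm_oppr; lra.
Qed.

Lemma exists_projection x :
  exists y, W y /\ forall z, W z -> inner (x - y) z = 0.
Proof.
have [y Wy ymin] := exists_nearest x; exists y; split=> // z Wz.
apply: orthogonal_of_shortest => a; rewrite -addrA -opprD.
by apply: ymin; apply: closed_subspaceD => //; exact: closed_subspaceZ.
Qed.

Lemma orth_proj_spec x :
  W (orth_proj W x) /\ forall z, W z -> inner (x - orth_proj W x) z = 0.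
Proof.
exact: (@xgetPex _ 0 [set y | W y /\ forall z, W z -> inner (x - y) z = 0]
  (exists_projection x)).
Qed.

Lemma orth_proj_in x : W (orth_proj W x).
Proof. exact: (orth_proj_spec x).1. Qed.

Lemma orth_proj_orth x z : W z -> inner (x - orth_proj W x) z = 0.
Proof. exact: (orth_proj_spec x).2. Qed.

Lemma orth_proj_unique x y :
  W y -> (forall z, W z -> inner (x - y) z = 0) -> orth_proj W x = y.
Proof.
move=> Wy yP; apply/eqP; rewrite -subr_eq0; apply/eqP/hnorm_eq0.
have Wd : W (orth_proj W x - y) by apply: closed_subspaceB => //; exact: orth_proj_in.
apply/eqP; rewrite -sqrf_eq0; apply/eqP/(@real_scalar_inj R k).
rewrite -inner_hnorm real_scalar0.
have {1}-> : orth_proj W x - y = (x - y) - (x - orth_proj W x).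
  by rewrite opprB [RHS]addrC addrA subrK.
by rewrite innerBl yP// orth_proj_orth// subrr.
Qed.

Lemma orth_projP a x y :
  orth_proj W (a *: x + y) = a *: orth_proj W x + orth_proj W y.
Proof.
apply: orth_proj_unique.
  by apply: closed_subspaceD; [apply: closed_subspaceZ|]; exact: orth_proj_in.
move=> z Wz; rewrite opprD addrACA -scalerBr.
by rewrite innerDl innerZl !orth_proj_orth// mulr0 addr0.
Qed.

Lemma orth_projB x y : orth_proj W (x - y) = orth_proj W x - orth_proj W y.
Proof. by rewrite addrC -scaleN1r orth_projP scaleN1r addrC. Qed.

Lemma orth_proj0 : orth_proj W 0 = 0.
Proof. by rewrite -[in LHS](subrr 0) orth_projB subrr. Qed.

Lemma orth_projD x y : orth_proj W (x + y) = orth_proj W x + orth_proj W y.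
Proof. by rewrite -[x]scale1r orth_projP !scale1r. Qed.

Lemma hnorm_orth_proj x : hnorm (orth_proj W x) <= hnorm x.
Proof.
have orth : inner (x - orth_proj W x) (orth_proj W x) = 0.
  exact/orth_proj_orth/orth_proj_in.
rewrite -(@ler_pXn2r _ 2) ?nnegrE ?hnorm_ge0//.
by rewrite -[in leRHS](subrK (orth_proj W x) x) hnorm_pythagoras// lerDr sqr_ge0.
Qed.

End ClosedSubspace.
End Projection.

(** * Closed spans *)

Section ClosedSpan.
Context {R : realType} {k : scalar_kind} {H : hilbertType R k}.
Implicit Types (x y z w : H) (a : scalar_field R k) (W S : set H).

Lemma closure_is_linear S :
  (forall a x y, S x -> S y -> S (a *: x + y)) ->
  forall a x y, closure S x -> closure S y -> closure S (a *: x + y).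
Proof.
move=> Slin a x y /closure_hnormP Sx /closure_hnormP Sy.
apply/closure_hnormP => e e0.
pose b := re_scalar `|a|.
have b0 : 0 <= b by rewrite -(@ler_real_scalar R k) real_scalar0 ge0_real_scalar.
have d0 : 0 < e / (b + 1) by rewrite divr_gt0// ltr_wpDl.
have {}d0 : 0 < e / (b + 1) / 2 by rewrite divr_gt0.
have [x' Sx' xx'] := Sx _ d0; have [y' Sy' yy'] := Sy _ (divr_gt0 e0 (@ltr0Sn R 1)).
exists (a *: x' + y'); first exact: Slin.
rewrite opprD addrACA -scalerBr; apply: le_lt_trans (ler_hnormD _ _) _.
rewrite hnormZ -/b; move: xx'; rewrite -mulrA mulrC -mulrA ltr_pdivlMl ?ltr_wpDl//.
have := hnorm_ge0 (x - x'); move: (hnorm _) yy' => p; move: (hnorm _) => q.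
rewrite mulrDl mul1r; lra.
Qed.

Lemma linear_span_is_linear S a x y :
  linear_span S x -> linear_span S y -> linear_span S (a *: x + y).
Proof.
move=> [m [b [s [Ss ->]]]] [n [c [t [St ->]]]].
exists (m + n)%N.
exists (fun i : 'I_(m + n) => match fintype.split i with inl j => a * b j | inr j => c j end).
exists (fun i : 'I_(m + n) => match fintype.split i with inl j => s j | inr j => t j end).
split; first by move=> i; case: (fintype.split i).
rewrite big_split_ord /= scaler_sumr; congr (_ + _); apply: eq_bigr => i _.
  by rewrite (unsplitK (inl i)) scalerA.
by rewrite (unsplitK (inr i)).
Qed.

Lemma closed_span_closed_subspace S : closed_subspace (closed_span S).
Proof.
have S0 : linear_span S 0.
  by exists 0%N, (fun=> 0), (fun=> 0); split; [case|rewrite big_ord0].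
split; [exact: subset_closure| |exact: closed_closure].
exact/closure_is_linear/linear_span_is_linear.
Qed.

Lemma subset_closed_span S : S `<=` closed_span S.
Proof.
move=> x Sx; apply: subset_closure.
exists 1%N, (fun=> 1), (fun=> x); split=> //.
by rewrite big_ord1 scale1r.
Qed.

(** The way to prove a property of all elements of a closed span: it must
    define a closed subspace and hold on the generators. *)
Lemma closed_span_min S W :
  closed_subspace W -> S `<=` W -> closed_span S `<=` W.
Proof.
move=> W_closed SW; have [W0 _ W_cl] := W_closed.
apply: subset_trans W_cl; apply: closureS => _ [n [a [s [Ss ->]]]].
elim/big_ind: _ => [//|x y|i _]; first exact: closed_subspaceD.
by apply: closed_subspaceZ => //; exact: SW.
Qed.

(** For closedness, orthogonality of [w] to [z] is read as the fact that no
    [w - a *: z] is shorter than [w], which is stable under limits in [z]. *)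
Lemma orthogonal_closed_subspace w :
  closed_subspace [set z | inner w z = 0].
Proof.
split=> [|a x y /= wx wy|z /closure_hnormP wz] /=.
- exact: inner0r.
- by rewrite innerDr innerZr wx wy mulr0 addr0.
apply: orthogonal_of_shortest => a; apply/ler_addgt0Pr => e e0.
pose b := re_scalar `|a|.
have b0 : 0 <= b by rewrite -(@ler_real_scalar R k) real_scalar0 ge0_real_scalar.
have [|s ws zs] := wz (e / (b + 1)); first by rewrite divr_gt0// ltr_wpDl.
have w_le : hnorm w <= hnorm (w - a *: s).
  rewrite -(@ler_pXn2r _ 2) ?nnegrE ?hnorm_ge0//.
  rewrite -scaleNr hnorm_pythagoras; first by rewrite lerDl sqr_ge0.
  by rewrite innerZr ws mulr0.
apply: (le_trans w_le).
have -> : w - a *: s = (w - a *: z) + a *: (z - s).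
  by rewrite scalerBr addrA subrK.
apply: le_trans (ler_hnormD _ _) _; rewrite lerD2l hnormZ -/b.
move: zs; rewrite ltr_pdivlMr ?ltr_wpDl//; have := hnorm_ge0 (z - s); nra.
Qed.

Lemma orthogonal_closed_span S w z :
  (forall s, S s -> inner w s = 0) -> closed_span S z -> inner w z = 0.
Proof.
by move=> wS; exact: (closed_span_min (orthogonal_closed_subspace w) wS).
Qed.

Lemma preimage_orth_proj_closed_subspace W V :
  closed_subspace W -> closed_subspace V ->
  closed_subspace [set z | V (orth_proj W z)].
Proof.
move=> Wc Vc; have [V0 Vlin Vcl] := Vc; split=> [|a x y Vx Vy|z] /=.
- by rewrite orth_proj0.
- by rewrite orth_projP//; exact: Vlin.
move=> /closure_hnormP Vz; apply: Vcl; apply/closure_hnormP => e /Vz[s Vs zs].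
exists (orth_proj W s) => //; apply: le_lt_trans zs.
by rewrite -orth_projB// hnorm_orth_proj.
Qed.

End ClosedSpan.

(** * Projections in a tensor product *)

Definition flip_tensor (R : realType) (k : scalar_kind) (H K T : hilbertType R k)
  (t : H -> K -> T) (y : K) (x : H) : T := t x y.

Lemma flip_tensor_bilinear (R : realType) (k : scalar_kind)
    (H K T : hilbertType R k) (t : {bilinear H -> K -> T}) :
  bilinear_for *:%R *:%R (flip_tensor t).
Proof.
by split=> z a x y; rewrite /flip_tensor; [exact: linearPr|exact: linearPl].
Qed.

HB.instance Definition _ (R : realType) (k : scalar_kind)
    (H K T : hilbertType R k) (t : {bilinear H -> K -> T}) :=
  bilinear_isBilinear.Build (scalar_field R k) K H T *:%R *:%R (flip_tensor t)
    (flip_tensor_bilinear t).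

Section Tensor.
Context {R : realType} {k : scalar_kind} {H K T : hilbertType R k}.
Implicit Types (W : set H) (Z : set K).

Lemma simple_tensors_flip (t : H -> K -> T) W Z :
  simple_tensors (flip_tensor t) Z W = simple_tensors t W Z.
Proof. by apply/seteqP; split=> _ [x [y [Wx Zy ->]]]; exists y, x. Qed.

Lemma tensor_subspace_flip (t : H -> K -> T) W Z :
  tensor_subspace (flip_tensor t) Z W = tensor_subspace t W Z.
Proof. by rewrite /tensor_subspace simple_tensors_flip. Qed.

Variables (t : {bilinear H -> K -> T}) (tensor : is_hilbert_tensor_product t).

Lemma inner_tensor x x' y y' :
  inner (t x y) (t x' y') = inner x x' * inner y y'.
Proof. exact: tensor.1. Qed.

Lemma flip_tensor_is_tensor_product : is_hilbert_tensor_product (flip_tensor t).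
Proof.
split=> [y y' x x'|]; first by rewrite inner_tensor mulrC.
by rewrite simple_tensors_flip; exact: tensor.2.
Qed.

Lemma hnorm_tensor x y : hnorm (t x y) ^+ 2 = hnorm x ^+ 2 * hnorm y ^+ 2.
Proof.
by apply: (@real_scalar_inj R k); rewrite real_scalarM -!inner_hnorm inner_tensor.
Qed.

Lemma tensor_in_tensor_subspace W Z x y :
  W x -> Z y -> tensor_subspace t W Z (t x y).
Proof. by move=> Wx Zy; apply: subset_closed_span; exists x, y. Qed.

(** The projection onto [W (x) K] is [P_W (x) 1]: the difference
    [(x - P_W x) (x) y] is orthogonal to every [x' (x) y'] with [x'] in [W]. *)
Lemma orth_proj_tensor W x y : closed_subspace W ->
  orth_proj (tensor_subspace t W setT) (t x y) = t (orth_proj W x) y.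
Proof.
move=> W_closed; apply: orth_proj_unique.
- exact: closed_span_closed_subspace.
- by apply: tensor_in_tensor_subspace => //; exact: orth_proj_in.
move=> z; apply: orthogonal_closed_span => _ [x' [y' [Wx' _ ->]]].
by rewrite -linearBl inner_tensor orth_proj_orth// mul0r.
Qed.

(** Gram-Schmidt in the second factor: each new [y] is replaced by its component
    orthogonal to the previous [e i], the rest being absorbed by bilinearity
    into the first factors. Vectors are neither normalized nor discarded: a
    zero [e i] gets the coefficient [0] by the convention on division. *)
Lemma linear_span_tensor_orthogonal z :
  linear_span (simple_tensors t setT setT) z ->
  exists n (x : nat -> H) (e : nat -> K),
    (forall i j, (i < n)%N -> (j < n)%N -> i != j -> inner (e i) (e j) = 0) /\
    z = \sum_(i < n) t (x i) (e i).
Proof.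
move=> [n [a [s [st ->]]]]; elim: n => [|n IHn] in a s st *.
  by exists 0%N, (fun=> 0), (fun=> 0); rewrite !big_ord0.
rewrite big_ord_recr /=.
have [|m [x [e [orth ->]]]] :=
  IHn (fun i => a (widen_ord (leqnSn n) i)) (fun i => s (widen_ord (leqnSn n) i)).
  by move=> i; exact: st.
have [x0 [y [_ _ ->]]] := st ord_max; rewrite -linearZl_LR /=.
move: (a _ *: x0) => {}x0.
pose c i := inner y (e i) / inner (e i) (e i).
pose r := y - \sum_(i < m) c i *: e i.
have r_orth j : (j < m)%N -> inner r (e j) = 0.
  move=> jm; rewrite /r innerBl inner_suml (bigD1 (Ordinal jm))//= big1.
    rewrite addr0 innerZl /c.
    have [ej0|/eqP ej0] := eqVneq (e j) 0; first by rewrite ej0 !inner0r mulr0 subrr.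
    by rewrite divfK ?subrr// lt0r_neq0// neq0_dnorm_gt0//; apply/eqP.
  move=> i ij; rewrite innerZl orth ?mulr0//.
exists m.+1, (fun i => if i == m then x0 else x i + c i *: x0).
exists (fun i => if i == m then r else e i); split.
  move=> i j; rewrite [(i < _)%N]ltnS [(j < _)%N]ltnS.
  rewrite [(i <= m)%N]leq_eqVlt [(j <= m)%N]leq_eqVlt.
  have [->|im] /= := eqVneq i m; have [->|jm] //= := eqVneq j m.
  - by move=> _ jm' _; exact: r_orth.
  - by move=> im' _ _; apply/inner_sym0/r_orth.
  - by move=> im' jm' ij; exact: orth.
rewrite big_ord_recr /= eqxx.
under [in RHS]eq_bigr => i _ do
  rewrite (ltn_eqF (ltn_ord i)) linearDl linearZl_LR /= -linearZr_LR.
rewrite big_split /= -addrA; congr (_ + _).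
by rewrite -linear_sumr -linearDr /r addrC subrK.
Qed.

Lemma hnorm_sum_orthogonal_tensors n (x : nat -> H) (e : nat -> K) :
  (forall i j, (i < n)%N -> (j < n)%N -> i != j -> inner (e i) (e j) = 0) ->
  hnorm (\sum_(i < n) t (x i) (e i)) ^+ 2 =
    \sum_(i < n) hnorm (x i) ^+ 2 * hnorm (e i) ^+ 2.
Proof.
elim: n => [|n IHn] orth; first by rewrite !big_ord0 hnorm0 expr0n.
rewrite !big_ord_recr /= hnorm_pythagoras.
  by rewrite hnorm_tensor IHn// => i j im jm; apply: orth; exact: ltnW.
rewrite inner_suml big1// => i _.
by rewrite inner_tensor orth ?mulr0 ?ltnS ?(ltnW (ltn_ord i)) ?(ltn_eqF (ltn_ord i)).
Qed.

Lemma orth_proj_sum_tensors W n (x : nat -> H) (e : nat -> K) :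
  closed_subspace W ->
  orth_proj (tensor_subspace t W setT) (\sum_(i < n) t (x i) (e i)) =
    \sum_(i < n) t (orth_proj W (x i)) (e i).
Proof.
move=> W_closed; have WT_closed := closed_span_closed_subspace (simple_tensors t W setT).
elim: n => [|n IHn]; first by rewrite !big_ord0 orth_proj0.
by rewrite !big_ord_recr /= orth_projD// IHn orth_proj_tensor.
Qed.

End Tensor.

Section TensorComposition.
Context {R : realType} {k : scalar_kind} {H K T : hilbertType R k}.
Variables (t : {bilinear H -> K -> T}) (tensor : is_hilbert_tensor_product t).

Lemma orth_proj_tensor_r (Z : set K) x y : closed_subspace Z ->
  orth_proj (tensor_subspace t setT Z) (t x y) = t x (orth_proj Z y).
Proof.
move=> Z_closed; rewrite -tensor_subspace_flip.
exact: (orth_proj_tensor (flip_tensor_is_tensor_product tensor) y x Z_closed).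
Qed.

(** The projections onto [W (x) K] and [H (x) Z] play the roles of
    [P_W (x) 1] and [1 (x) P_Z], whose product is [P_W (x) P_Z].
    With [P], [Q] as in the proof, [z - P z] and [P z - Q (P z)] are orthogonal
    to [W (x) Z], and [1 (x) P_Z] maps [W (x) K] into [W (x) Z], as can be
    checked on simple tensors. *)
Lemma orth_proj_tensor_subspace (W : set H) (Z : set K) z :
  closed_subspace W -> closed_subspace Z ->
  orth_proj (tensor_subspace t W Z) z =
    orth_proj (tensor_subspace t setT Z) (orth_proj (tensor_subspace t W setT) z).
Proof.
move=> W_closed Z_closed.
have closedT W' Z' : closed_subspace (tensor_subspace t W' Z').
  exact: closed_span_closed_subspace.
have sub W' W'' Z' Z'' : W' `<=` W'' -> Z' `<=` Z'' ->
    tensor_subspace t W' Z' `<=` tensor_subspace t W'' Z''.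
  move=> WW ZZ; apply: closed_span_min => // _ [x [y [Wx Zy ->]]].
  by apply: tensor_in_tensor_subspace; [exact: WW|exact: ZZ].
set P := orth_proj (tensor_subspace t W setT).
set Q := orth_proj (tensor_subspace t setT Z).
apply: orth_proj_unique => // [|s Ws].
  have V_closed : closed_subspace [set z | tensor_subspace t W Z (Q z)].
    exact: preimage_orth_proj_closed_subspace.
  apply: (closed_span_min V_closed _ (orth_proj_in (closedT W setT) z)).
  move=> _ [x [y [Wx _ ->]]] /=; rewrite /Q orth_proj_tensor_r//.
  by apply: tensor_in_tensor_subspace => //; exact: orth_proj_in.
have -> : z - Q (P z) = (z - P z) + (P z - Q (P z)) by rewrite addrA subrK.
rewrite innerDl !orth_proj_orth ?addr0//; exact: (sub _ _ _ _ _ _ _ Ws).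
Qed.

End TensorComposition.

(** * Sums of nonnegative extended reals *)

Section EsumScale.
Context {R : realType}.

(** One inequality holds for each finite partial sum; the other one is the same
    inequality for the factor [c^-1]. *)
Lemma esumZl (I : choiceType) (c : R) (a : I -> \bar R) :
  0 <= c -> (forall i, 0 <= a i)%E ->
  (\esum_(i in [set: I]) (c%:E * a i) = c%:E * \esum_(i in [set: I]) a i)%E.
Proof.
have le_sup (d : R) (b : I -> \bar R) : 0 <= d -> (forall i : I, 0 <= b i)%E ->
    (\esum_(i in [set: I]) (d%:E * b i) <= d%:E * \esum_(i in [set: I]) b i)%E.
  move=> d0 b0; apply: ge_ereal_sup => _ [X [finX _] <-].
  rewrite fsbig_finite//= -ge0_sume_distrr//.
  apply: lee_wpmul2l; first by rewrite lee_fin.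
  by apply: esum_ge; exists X => //; rewrite fsbig_finite.
rewrite le0r => /orP[/eqP ->|c0] a0.
  by rewrite mul0e; apply: esum1 => i _; rewrite mul0e.
apply/eqP; rewrite eq_le le_sup ?(ltW c0)//=.
rewrite -lee_pdivlMl//; apply: le_trans (le_sup _ _ _ _).
- by apply: le_esum => i _; rewrite muleA -EFinM mulVf ?gt_eqF// mul1e.
- by rewrite invr_ge0 ltW.
- by move=> i; rewrite mule_ge0// lee_fin ltW.
Qed.

End EsumScale.

(** * Quadratic inequalities on a dense subset *)

Section Young.
Context {R : realType} {k : scalar_kind} {H : hilbertType R k}.
Implicit Types (f g : H -> R) (D : set H).

(** A property of squares of seminorms that is stable under sums and multiples
    and loses nothing in the limit: the factor of [f x] can be taken arbitrarily
    close to [1], so that the constants of the frame bounds survive. *)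
Definition young_bound f :=
  forall c x y, 0 < c -> f (x + y) <= (1 + c) * f x + (1 + c^-1) * f y.

Lemma young_bound_hnorm : young_bound (fun x => hnorm x ^+ 2).
Proof.
move=> c x y c0.
have le2 : hnorm (x + y) ^+ 2 <= (hnorm x + hnorm y) ^+ 2.
  by rewrite lerXn2r ?nnegrE ?addr_ge0 ?hnorm_ge0// ler_hnormD.
apply: le_trans le2 _; rewrite -subr_ge0.
have -> : (1 + c) * hnorm x ^+ 2 + (1 + c^-1) * hnorm y ^+ 2 -
    (hnorm x + hnorm y) ^+ 2 = c * (hnorm x - c^-1 * hnorm y) ^+ 2.
  by field; rewrite gt_eqF.
by rewrite mulr_ge0 ?sqr_ge0// ltW.
Qed.

Lemma young_boundZ f a : 0 <= a -> young_bound f -> young_bound (fun x => a * f x).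
Proof.
move=> a0 fY c x y c0; apply: le_trans (ler_wpM2l a0 (fY _ _ _ c0)) _.
by rewrite mulrDr (mulrCA a) (mulrCA a).
Qed.

Lemma young_bound_sum (I : Type) (r : seq I) (F : I -> H -> R) :
  (forall i, young_bound (F i)) -> young_bound (fun x => \sum_(i <- r) F i x).
Proof.
move=> FY c x y c0; rewrite !mulr_sumr -big_split /=.
by apply: ler_sum => i _; exact: FY.
Qed.

Lemma young_bound_orth_proj W : closed_subspace W ->
  young_bound (fun x => hnorm (orth_proj W x) ^+ 2).
Proof.
by move=> W_closed c x y c0; rewrite orth_projD//; exact: young_bound_hnorm.
Qed.

Lemma le_of_scale (a b : R) : 0 <= b ->
  (forall c, 0 < c -> a <= (1 + c) ^+ 2 * b) -> a <= b.
Proof.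
move=> b0 ab; apply/ler_addgt0Pr => e e0.
pose c := Num.min 1 (e / (3 * b + 1)).
have den0 : 0 < 3 * b + 1 by lra.
have c0 : 0 < c by rewrite lt_min ltr01 divr_gt0.
have c1 : c <= 1 by rewrite ge_min lexx.
have ce : c * (3 * b + 1) <= e by rewrite -ler_pdivlMr// ge_min lexx orbT.
apply: le_trans (ab _ c0) _.
have : c ^+ 2 * b <= c * b by rewrite ler_wpM2r// expr2 ger_pMr.
nra.
Qed.

Lemma dense_closure D : dense D -> forall z, closure D z.
Proof.
move=> Dd z B Bz; have [|x [/interior_subset Bx Dx]] := Dd _ _ (open_interior B).
  by exists z.
by exists x.
Qed.

(** For [s] in [D] close to [z], pass from [f z] to [f s], then to [g s], then
    back to [g z]. Each change of point costs a factor [1 + c] and a multiple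
    of [hnorm (z - s) ^+ 2]; let first [s] tend to [z], then [c] to [0]. *)
Lemma le_young_bound_dense D f g (M : R) :
  dense D -> 0 <= M -> (forall x, 0 <= g x) ->
  young_bound f -> (forall x, f x <= M * hnorm x ^+ 2) ->
  young_bound g -> (forall x, g x <= M * hnorm x ^+ 2) ->
  (forall s, D s -> f s <= g s) -> forall z, f z <= g z.
Proof.
move=> Dd M0 g0 fY fM gY gM fg z; apply: le_of_scale => // c c0.
have ci0 : 0 < c^-1 by rewrite invr_gt0.
pose C := (1 + c) * (1 + c^-1) * M + (1 + c^-1) * M.
have C0 : 0 <= C by rewrite addr_ge0 ?mulr_ge0 ?addr_ge0// ltW.
have via s : D s -> f z <= (1 + c) ^+ 2 * g z + C * hnorm (z - s) ^+ 2.
  move=> Ds; have := fY c s (z - s) c0; rewrite addrCA subrr addr0 => fz.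
  have := gY c z (s - z) c0; rewrite addrCA subrr addr0 => gs.
  have := gM (s - z); rewrite -(opprB z s) hnorm_oppr opprB => gsz.
  have cc : 0 <= 1 + c by lra.
  have cci : 0 <= 1 + c^-1 by lra.
  have h1 := ler_wpM2l cci (fM (z - s)).
  have h2 := ler_wpM2l cc (fg _ Ds).
  have h3 := ler_wpM2l cc gs.
  have h4 := ler_wpM2l cc (ler_wpM2l cci gsz).
  rewrite /C expr2; move: h1 h2 h3 h4; rewrite mulrDr !mulrDl !mulrA => *.
  lra.
apply/ler_addgt0Pr => e e0.
pose d := Num.min 1 (e / (C + 1)).
have C1 : 0 < C + 1 by lra.
have d0 : 0 < d by rewrite lt_min ltr01 divr_gt0.
have /closure_hnormP/(_ _ d0)[s Ds zs] : closure D z by exact: dense_closure.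
apply: le_trans (via _ Ds) _; rewrite lerD2l.
have d1 : d <= 1 by rewrite ge_min lexx.
have de : d * (C + 1) <= e by rewrite -ler_pdivlMr// ge_min lexx orbT.
have sq : hnorm (z - s) ^+ 2 <= d.
  apply: le_trans (ltW zs); rewrite expr2 ler_piMr ?hnorm_ge0//.
  exact: le_trans (ltW zs) d1.
nra.
Qed.

End Young.

(** * Frames in a tensor product *)

Section FrameTensorFactor.
Context {R : realType} {k : scalar_kind} {H K T : hilbertType R k}.
Variables (t : {bilinear H -> K -> T}) (tensor : is_hilbert_tensor_product t).
Context {I : countType}.
Variables (W : I -> set H) (u : I -> R) (A B : R).
Variable frameW : frame_of_subspaces W u A B.

Let W_closed i : closed_subspace (W i). Proof. by case: frameW. Qed.
Let A_gt0 : 0 < A. Proof. by case: frameW. Qed.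
Let B_gt0 : 0 < B. Proof. by case: frameW. Qed.
Let WT i := tensor_subspace t (W i) setT.
Let WT_closed i : closed_subspace (WT i).
Proof. exact: closed_span_closed_subspace. Qed.

Let energy z : \bar R :=
  \esum_(i in [set: I]) (u i ^+ 2 * hnorm (orth_proj (WT i) z) ^+ 2)%:E.

(** Gram-Schmidt reduces the frame inequalities at [z] to a nonnegative
    combination of those satisfied by [W] at the vectors [x j]. *)
Let energy_span z : linear_span (simple_tensors t setT setT) z ->
  ((A * hnorm z ^+ 2)%:E <= energy z /\ energy z <= (B * hnorm z ^+ 2)%:E)%E.
Proof.
move=> /linear_span_tensor_orthogonal[n [x [e [orth ->]]]].
have -> : (energy (\sum_(i < n) t (x i) (e i))%R =
    \sum_(j < n) (hnorm (e j) ^+ 2)%:E *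
      \esum_(i in [set: I]) (u i ^+ 2 * hnorm (orth_proj (W i) (x j)) ^+ 2)%:E)%E.
  transitivity (\esum_(i in [set: I]) \sum_(j < n) ((hnorm (e j) ^+ 2)%:E *
      (u i ^+ 2 * hnorm (orth_proj (W i) (x j)) ^+ 2)%:E))%E.
    apply: eq_esum => i _.
    rewrite (orth_proj_sum_tensors tensor)//.
    rewrite (hnorm_sum_orthogonal_tensors tensor (fun j => orth_proj (W i) (x j)) orth).
    rewrite mulr_sumr -sumEFin; apply: eq_bigr => j _.
    by rewrite -EFinM; congr _%:E; ring.
  rewrite esum_sum; last first.
    by move=> i j _ _; rewrite -EFinM lee_fin mulr_ge0 ?sqr_ge0 1?mulr_ge0 ?sqr_ge0.
  apply: eq_bigr => j _; rewrite esumZl ?sqr_ge0// => i.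
  by rewrite lee_fin mulr_ge0 ?sqr_ge0.
have [_ _ _ _ bounds] := frameW.
rewrite (hnorm_sum_orthogonal_tensors tensor)// !mulr_sumr -!sumEFin.
have e2 j : (0 <= (hnorm (e j) ^+ 2)%:E :> \bar R)%E by rewrite lee_fin sqr_ge0.
split; apply: lee_sum => j _; rewrite mulrA mulrC [(_ ^+ 2 * (_ * _))%:E]EFinM.
  by apply: lee_wpmul2l => //; exact: (bounds (x j)).1.
by apply: lee_wpmul2l => //; exact: (bounds (x j)).2.
Qed.

Let term_ge0 z i : (0 <= (u i ^+ 2 * hnorm (orth_proj (WT i) z) ^+ 2)%:E)%E.
Proof. by rewrite lee_fin mulr_ge0 ?sqr_ge0. Qed.

Let hnorm_WT z i : hnorm (orth_proj (WT i) z) ^+ 2 <= hnorm z ^+ 2.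
Proof. by rewrite lerXn2r ?nnegrE ?hnorm_ge0// hnorm_orth_proj. Qed.

(** The upper bound comes first, one finite partial sum at a time, as these
    are bounded by a multiple of the squared norm; it makes the
    whole energy finite and bounded, as the passage to the limit in
    the lower bound demands. *)
Let energy_le z : (energy z <= (B * hnorm z ^+ 2)%:E)%E.
Proof.
apply: ge_ereal_sup => _ [X [finX _] <-].
rewrite fsbig_finite//= sumEFin lee_fin; set r := finmap.enum_fset (fset_set X).
pose f z := \sum_(i <- r) u i ^+ 2 * hnorm (orth_proj (WT i) z) ^+ 2.
have fsum_ge0 : 0 <= \sum_(i <- r) u i ^+ 2 by apply: sumr_ge0 => i _; exact: sqr_ge0.
move: z; apply: (@le_young_bound_dense _ _ _ _ f _ (\sum_(i <- r) u i ^+ 2 + B)).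
- exact: tensor.2.
- by rewrite addr_ge0// ltW.
- by move=> z; rewrite mulr_ge0 ?sqr_ge0// ltW.
- apply: young_bound_sum => i; apply: young_boundZ; first exact: sqr_ge0.
  exact: young_bound_orth_proj.
- move=> z; rewrite mulrDl -[leLHS]addr0; apply: lerD; last first.
    by rewrite mulr_ge0 ?sqr_ge0// ltW.
  by rewrite mulr_suml; apply: ler_sum => i _; rewrite ler_wpM2l ?sqr_ge0.
- by apply: young_boundZ; [exact: ltW|exact: young_bound_hnorm].
- by move=> z; rewrite ler_wpM2r ?sqr_ge0// lerDr.
move=> s /energy_span[_]; rewrite -lee_fin; apply: le_trans.
by apply: esum_ge; exists X => //; rewrite fsbig_finite//= sumEFin.
Qed.

Let energy_fin z : energy z = (fine (energy z))%:E.
Proof.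
rewrite fineK// ge0_fin_numE; first exact: le_lt_trans (energy_le z) (ltry _).
exact: esum_ge0.
Qed.

Let energy_ge z : ((A * hnorm z ^+ 2)%:E <= energy z)%E.
Proof.
rewrite energy_fin lee_fin; move: z.
apply: (@le_young_bound_dense _ _ _ _ _ (fun z => fine (energy z)) (A + B)).
- exact: tensor.2.
- by rewrite addr_ge0// ltW.
- by move=> z; rewrite fine_ge0// esum_ge0.
- by apply: young_boundZ; [exact: ltW|exact: young_bound_hnorm].
- by move=> z; rewrite ler_wpM2r ?sqr_ge0// lerDl ltW.
- move=> c x y c0; rewrite -lee_fin EFinD !EFinM -!energy_fin.
  have c1 : 0 <= 1 + c by rewrite addr_ge0// ltW.
  have c2 : 0 <= 1 + c^-1 by rewrite addr_ge0// invr_ge0 ltW.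
  rewrite -!esumZl// -esumD; last 2 first.
  + by move=> i _; rewrite mule_ge0.
  + by move=> i _; rewrite mule_ge0.
  apply: le_esum => i _; rewrite -!EFinM -EFinD lee_fin.
  apply: (young_boundZ _ (young_bound_orth_proj (WT_closed i))) => //.
  exact: sqr_ge0.
- move=> z; rewrite -lee_fin -energy_fin; apply: le_trans (energy_le z) _.
  by rewrite lee_fin ler_wpM2r ?sqr_ge0// lerDr ltW.
by move=> s /energy_span[]; rewrite energy_fin lee_fin.
Qed.

Lemma frame_tensor_l :
  frame_of_subspaces (fun i => tensor_subspace t (W i) setT) u A B.
Proof.
case: frameW => _ u_gt0 _ _ _; split=> // z.
by split; [exact: energy_ge|exact: energy_le].
Qed.

End FrameTensorFactor.

Section FrameTensor.
Context {R : realType} {k : scalar_kind} {H K T : hilbertType R k}.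
Variables (t : {bilinear H -> K -> T}) (tensor : is_hilbert_tensor_product t).

Lemma frame_tensor_r (J : countType) (Z : J -> set K) (v : J -> R) (A B : R) :
  frame_of_subspaces Z v A B ->
  frame_of_subspaces (fun j => tensor_subspace t setT (Z j)) v A B.
Proof.
move=> /(frame_tensor_l (flip_tensor_is_tensor_product tensor)).
by under eq_fun do rewrite tensor_subspace_flip.
Qed.

Lemma frame_tensor (I J : countType) (W : I -> set H) (u : I -> R) (A B : R)
    (Z : J -> set K) (v : J -> R) (A' B' : R) :
  frame_of_subspaces W u A B -> frame_of_subspaces Z v A' B' ->
  frame_of_subspaces
    (fun p : I * J => tensor_subspace t (W p.1) (Z p.2))
    (fun p => u p.1 * v p.2) (A * A') (B * B').
Proof.
move=> frameW frameZ.
have [W_closed u_gt0 A_gt0 B_gt0 _] := frameW.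
have [Z_closed v_gt0 A'_gt0 B'_gt0 _] := frameZ.
have [_ _ _ _ boundW] := frame_tensor_l tensor frameW.
have [_ _ _ _ boundZ] := frame_tensor_r frameZ.
split=> [p|p|||z]; rewrite ?mulr_gt0//; first exact: closed_span_closed_subspace.
pose x i := orth_proj (tensor_subspace t (W i) setT) z.
pose b i := (\esum_(j in [set: J])
  (v j ^+ 2 * hnorm (orth_proj (tensor_subspace t setT (Z j)) (x i)) ^+ 2)%:E)%E.
have u2_ge0 i : (0 <= (u i ^+ 2)%:E :> \bar R)%E by rewrite lee_fin sqr_ge0.
have -> : (\esum_(p in [set: I * J]) ((u p.1 * v p.2) ^+ 2 *
      hnorm (orth_proj (tensor_subspace t (W p.1) (Z p.2)) z) ^+ 2)%:E =
    \esum_(i in [set: I]) ((u i ^+ 2)%:E * b i))%E.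
  under [RHS]eq_esum => i _.
    rewrite -esumZl ?sqr_ge0//; last first.
      by move=> j; rewrite lee_fin mulr_ge0 ?sqr_ge0.
    over.
  rewrite esum_esum; last first.
    by move=> i j _ _; rewrite mule_ge0 ?lee_fin ?sqr_ge0// mulr_ge0 ?sqr_ge0.
  have -> : [set: I] `*`` (fun=> [set: J]) = [set: I * J].
    by apply/seteqP; split.
  apply: eq_esum => -[i j] _ /=.
  by rewrite (orth_proj_tensor_subspace tensor)// -EFinM exprMn -mulrA.
have [lbW ubW] := boundW z.
have scaled (c : R) : 0 < c ->
    (\esum_(i in [set: I]) ((u i ^+ 2)%:E * (c * hnorm (x i) ^+ 2)%:E) =
     c%:E * \esum_(i in [set: I]) (u i ^+ 2 * hnorm (x i) ^+ 2)%:E)%E.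
  move=> c0; rewrite -esumZl ?ltW//; last first.
    by move=> i; rewrite lee_fin mulr_ge0 ?sqr_ge0.
  by apply: eq_esum => i _; rewrite -!EFinM mulrCA.
split.
- apply: (@le_trans _ _ (\esum_(i in [set: I])
      ((u i ^+ 2)%:E * (A' * hnorm (x i) ^+ 2)%:E))%E).
    rewrite scaled// (mulrC A) -mulrA EFinM.
    by apply: lee_wpmul2l; [rewrite lee_fin ltW|exact: lbW].
  by apply: le_esum => i _; apply: lee_wpmul2l => //; exact: (boundZ (x i)).1.
- apply: (@le_trans _ _ (\esum_(i in [set: I])
      ((u i ^+ 2)%:E * (B' * hnorm (x i) ^+ 2)%:E))%E).
    by apply: le_esum => i _; apply: lee_wpmul2l => //; exact: (boundZ (x i)).2.
  rewrite scaled// (mulrC B) -mulrA [leRHS]EFinM.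
  by apply: lee_wpmul2l; [rewrite lee_fin ltW|exact: ubW].
Qed.

End FrameTensor.

Theorem theorem3p7 (R : realType) (k : scalar_kind)
    (H K HK : hilbertType R k) (t : {bilinear H -> K -> HK})
    (sepH : separable_space H) (sepK : separable_space K)
    (tensorHK : is_hilbert_tensor_product t)
    (I J : countType)
    (W : I -> set H) (u : I -> R) (A B : R)
    (Z : J -> set K) (v : J -> R) (A' B' : R)
    (frameW : frame_of_subspaces W u A B)
    (frameZ : frame_of_subspaces Z v A' B') :
  let WZ (p : I * J) := tensor_subspace t (W p.1) (Z p.2) in
  let uv (p : I * J) := u p.1 * v p.2 in
  [/\ frame_of_subspaces WZ uv (A * A') (B * B'),
      (tight_frame_of_subspaces W u -> tight_frame_of_subspaces Z v ->
         tight_frame_of_subspaces WZ uv)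
    & (parseval_frame_of_subspaces W u -> parseval_frame_of_subspaces Z v ->
         parseval_frame_of_subspaces WZ uv)].
Proof.
split=> [|[C tightW] [D tightZ]|parsW parsZ]; first exact: frame_tensor.
  by exists (C * D); exact: frame_tensor.
by have := frame_tensor tensorHK parsW parsZ; rewrite mulr1.
Qed.
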